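(* Define integers $N_r$ for $r=0,1,\ldots,13$ by $N_0=294$, $N_1=589$, $N_2=394$, $N_3=367$, $N_4=396$, $N_5=439$, $N_6=510$, $N_7=329$, $N_8=540$, $N_9=457$, $N_{10}=430$, $N_{11}=459$, $N_{12}=432$, $N_{13}=447$. For each $r\in\{0,1,\ldots,13\}$, if $n\equiv r \pmod{14}$ and $n\ge N_r$, then the alternating group $A_n$ is a doubly Hurwitz Beauville group. In particular, $A_n$ is a doubly Hurwitz Beauville group for all $n\ge 589$.
   Context: A generating triple of type $(2,3,7)$ (a Hurwitz triple) for a finite group $G$ is a triple $(x,y,z)$ of elements of $G$ of orders $2,3,7$ respectively, with $xyz=1$ and $G=\langle x,y,z\rangle$. A finite group $G$ is a doubly Hurwitz Beauville group (dHB group) if it has two generating triples $(x_1,y_1,z_1)$ and $(x_2,y_2,z_2)$ of type $(2,3,7)$ such that no non-identity power of $x_1$, $y_1$ or $z_1$ is conjugate in $G$ to a power of $x_2$, $y_2$ or $z_2$. *)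

(* Defs.v *)
From mathcomp Require Import all_boot all_fingroup all_solvable.

Set Implicit Arguments.
Unset Strict Implicit.
Unset Printing Implicit Defensive.

Local Open Scope group_scope.

Definition hurwitz_triple (gT : finGroupType) (G : {group gT})
    (x y z : gT) : Prop :=
  [/\ x \in G, y \in G & z \in G] /\
  [/\ #[x] = 2, #[y] = 3, #[z] = 7, x * y * z = 1
    & <<[set x; y; z]>> = G :> {set gT}].

(* Natural exponents suffice: in a finite group every integer power of an
   element is also a power with a natural exponent. *)
Definition no_conjugate_powers (gT : finGroupType) (G : {group gT})
    (a b : gT) : Prop :=
  forall i j : nat, a ^+ i != 1 ->
    ~ exists2 g, g \in G & (a ^+ i) ^ g = b ^+ j.

Definition dHB_group (gT : finGroupType) (G : {group gT}) : Prop :=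
  exists x1 y1 z1 x2 y2 z2 : gT,
    [/\ hurwitz_triple G x1 y1 z1,
        hurwitz_triple G x2 y2 z2
      & forall a b : gT, a \in [set x1; y1; z1] -> b \in [set x2; y2; z2] ->
          no_conjugate_powers G a b].

Definition dHB_bound (r : nat) : nat :=
  nth 0 [:: 294; 589; 394; 367; 396; 439; 510;
            329; 540; 457; 430; 459; 432; 447] r.

(* Main.v *)
Require Import Defs.
From mathcomp Require Import all_boot all_fingroup all_solvable.

Set Implicit Arguments.
Unset Strict Implicit.
Unset Printing Implicit Defensive.

(* Conder's coset diagrams.  Small diagrams of the (2,3,7) triangle group are joined into a linear
   chain along (1)-handles.  In the chains used here every cycle of the commutator w = x y x y^-1
   lies in at most two consecutive pieces, and all cycle lengths are prime to 7 except for one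
   cycle C of length 7.  So for a suitable L prime to 7 the power u = w^L is a 7-cycle on C, and
   since C and its image under y share exactly one point, [u, u^y] is a 3-cycle.  Moreover C
   contains an edge of x and an edge of y; being equal or moved by a common 3-cycle of the group
   is an invariant equivalence of points, whose class containing C is therefore stable under x
   and y.  So it contains all points, and the group is alternating.

   For each residue of n modulo 14 two such chains of equal degree are lengthened alike, by
   repeating a piece of degree 42 and ending with a piece of degree 0, 14 or 28.  Their x's,
   y's and z's always have different numbers of fixed points, and as 2, 3, 7 are distinct primes
   this rules out conjugate powers. *)

(** * Recognising the alternating group *)

Definition cyc3 (T : finType) (a b d : T) : {perm T} := (tperm a b * tperm a d)%g.

Section ThreeCycles.
Local Open Scope group_scope.
Variable T : finType.
Implicit Types (a b d s t : T) (p q u v : {perm T}).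

Lemma cyc3E a b d s : uniq [:: a; b; d] ->
  cyc3 a b d s = if s == a then b else if s == b then d else if s == d then a else s.
Proof.
rewrite /= !inE negb_or andbT -andbA => /and3P[ab ad bd]; rewrite permM.
case: (tpermP a b s) => [->|->|/eqP sa /eqP sb].
- by rewrite eqxx tpermD // eq_sym.
- by rewrite tpermL eqxx eq_sym (negPf ab).
rewrite (negPf sa) (negPf sb); case: eqVneq => [->|sd]; first exact: tpermR.
by rewrite tpermD // eq_sym.
Qed.

Lemma cyc3J a b d p : cyc3 a b d ^ p = cyc3 (p a) (p b) (p d).
Proof. by rewrite /cyc3 conjMg !tpermJ. Qed.

Lemma cyc3V a b d : (cyc3 a b d)^-1 = cyc3 a d b.
Proof. by rewrite /cyc3 invMg !tpermV. Qed.

Lemma cyc3_rot a b d : uniq [:: a; b; d] -> cyc3 b d a = cyc3 a b d.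
Proof.
move=> U; have U' : uniq [:: b; d; a] by rewrite -(rot_uniq 1) in U.
apply/permP=> s; rewrite !cyc3E //.
case: (eqVneq s a) => // ->; move: U; rewrite /= !inE negb_or andbT -andbA.
by case/and3P=> /negPf-> /negPf->.
Qed.

Lemma cyc3_even a b d : uniq [:: a; b; d] -> cyc3 a b d \in 'Alt_T.
Proof.
rewrite Alt_even odd_permM !odd_tperm /= !inE negb_or -andbA.
by case/and3P=> -> ->.
Qed.

Lemma perm_fixV u s : (u^-1 s == s) = (u s == s).
Proof. by apply/eqP/eqP=> E; rewrite -{1}E ?permKV ?permK. Qed.

(** Away from [t] each of [u] and [v] fixes what the other moves, so the commutator only sees [t]
    and its two images. *)
Lemma commg_cyc3 u v t : (forall s, u s != s -> v s != s -> s = t) ->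
  u t != t -> v t != t -> uniq [:: t; v t; u t] /\ [~ u, v] = cyc3 t (v t) (u t).
Proof.
move=> suppUV ut vt.
have mv p s : p s != s -> p (p s) != p s by rewrite (inj_eq perm_inj).
have U : uniq [:: t; v t; u t].
  rewrite /= !inE negb_or andbT -andbA eq_sym vt eq_sym ut /=.
  apply: contra_neq (ut) => vu; apply: suppUV; first exact: mv.
  by rewrite -vu; exact: mv.
split=> //; have fixu s : v s != s -> s != t -> u s = s.
  by move=> vs st; apply/eqP; apply: contraNT st => us; apply/eqP/suppUV.
have fixv s : u s != s -> s != t -> v s = s.
  by move=> us st; apply/eqP; apply: contraNT st => vs; apply/eqP/suppUV.
have Vfix p s : p s = s -> p^-1 s = s by move=> E; rewrite -{1}E permK.
have Vmv p s : p s != s -> p (p^-1 s) != p^-1 s.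
  by rewrite permKV; apply: contraNneq => E; rewrite {1}E permKV.
apply/permP=> s; rewrite cyc3E // commgEl conjgE !permM.
case: (eqVneq s t) => [->|st].
  rewrite (Vfix v) ?permKV //; apply: fixv; first exact: Vmv.
  by apply: contraNneq ut => E; rewrite -{1}E permKV.
case: (eqVneq s (v t)) => [->|svt].
  have vvt : v (v t) != v t by exact: mv.
  rewrite (Vfix u) ?permK; last by apply: fixu.
  by apply: fixv; [exact: mv|].
case: (eqVneq s (u t)) => [->|sut].
  rewrite permK fixu; [by rewrite permKV|exact: Vmv|].
  by apply: contraNneq vt => E; rewrite -{1}E permKV.
have [us|us] := eqVneq (u s) s.
  rewrite (Vfix u) //; have [vs|vs] := eqVneq (v s) s.
    by rewrite (Vfix v) // us.
  rewrite fixu; [by rewrite permKV|exact: Vmv|].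
  by apply: contra_neq svt => <-; rewrite permKV.
rewrite (Vfix v); last first.
  by apply: fixv; [exact: Vmv|apply: contra_neq sut => <-; rewrite permKV].
by rewrite permKV; apply: fixv.
Qed.

(** * Subgroups linking points by 3-cycles *)

Section Generation.
Variable H : {group {perm T}}.

Definition linked a b := a = b \/ exists2 d, uniq [:: a; b; d] & cyc3 a b d \in H.

Lemma uniq3C a b d : uniq [:: b; a; d] = uniq [:: a; b; d].
Proof.
by rewrite /= !inE !negb_or !andbT (eq_sym b); case: (a == b) => //=; rewrite andbC.
Qed.

Lemma uniq3CA a b d : uniq [:: a; d; b] = uniq [:: a; b; d].
Proof. by rewrite -(rot_uniq 1) uniq3C -(rot_uniq 1) uniq3C. Qed.

Lemma linked_sym a b : linked a b -> linked b a.
Proof.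
case=> [->|[d U Hd]]; [by left|right; exists d; first by rewrite uniq3C].
by rewrite -cyc3_rot; [rewrite -cyc3V groupV|rewrite uniq3C].
Qed.

Lemma linked_act p a b : p \in H -> linked a b -> linked (p a) (p b).
Proof.
move=> Hp [->|[d U Hd]]; [by left|right; exists (p d)].
  by rewrite -[[:: _; _; _]]/(map p [:: a; b; d]) map_inj_uniq //; apply: perm_inj.
by rewrite -cyc3J groupJ.
Qed.

(** The 3-cycle through [a], [b], [e] either contains [d], or a power of it takes [b] to [a] and
    fixes [d], transporting the link of [b] and [d]. *)
Lemma linked_trans a b d : linked a b -> linked b d -> linked a d.
Proof.
case=> [->//|[e U He]] [<-|[f V Hf]]; first by right; exists e.
have [<-|ad] := eqVneq a d; first by left.
have [ed|ed] := eqVneq e d.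
  by right; exists b; [rewrite uniq3CA -ed|rewrite -cyc3V groupV -ed].
have U' : uniq [:: e; b; a] by rewrite -(rot_uniq 2) uniq3CA.
have Hs : cyc3 e b a \in H.
  by rewrite -(cyc3_rot U') -cyc3V groupV (cyc3_rot U).
have := linked_act Hs (or_intror (ex_intro2 _ _ f V Hf)).
have [_ [/negPf eb /negPf bd]] : a != e /\ e != b /\ b != d.
  move: U V; rewrite /= !inE !negb_or -!andbA => /and4P[_ ae be _] /and4P[bd _ _ _].
  by rewrite ae eq_sym be bd.
rewrite !cyc3E // eqxx (eq_sym b) eb (eq_sym d e) (negPf ed) (eq_sym d b) bd.
by rewrite (eq_sym d a) (negPf ad).
Qed.

(** Take 3-cycles of [H] through [a], [b], [e] and through [b], [d], [f]. If [e = d] or [f = a], one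
    of them is the desired one; if [e = f], a conjugate is its inverse; otherwise they meet only in
    [b] and their commutator is the desired one. *)
Lemma linked_cyc3 : (forall a b, linked a b) ->
  forall a b d, uniq [:: a; b; d] -> cyc3 a b d \in H.
Proof.
move=> tot a b d U.
have [/negPf ab [/negPf ad /negPf bd]] : a != b /\ a != d /\ b != d.
  by move: U; rewrite /= !inE negb_or -andbA => /and4P[].
have [/eqP|[e V He]] := tot a b; first by rewrite ab.
have [ed|ed] := eqVneq e d; first by rewrite -ed.
have [/eqP|[f W Hf]] := tot b d; first by rewrite bd.
have [fa|fa] := eqVneq f a; first by rewrite -cyc3_rot // -fa.
have Hs : cyc3 a e b \in H by rewrite -cyc3V groupV.
have V' : uniq [:: a; e; b] by rewrite uniq3CA.
have [/negPf ae /negPf eb] : a != e /\ e != b.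
  by move: V'; rewrite /= !inE negb_or -andbA => /and4P[].
have [fe|fe] := eqVneq f e.
  have : cyc3 b d e ^ cyc3 a e b \in H by rewrite groupJ // -fe.
  rewrite cyc3J !cyc3E // !eqxx (eq_sym b a) ab (eq_sym b e) eb.
  rewrite (eq_sym d a) ad (eq_sym d e) (negPf ed) (eq_sym d b) bd (eq_sym e a) ae.
  rewrite -cyc3V groupV => HH.
  by have := HH.
have [fb fd] : b != f /\ d != f.
  by move: W; rewrite /= !inE negb_or -andbA => /and4P[].
rewrite -(cyc3_rot U).
have -> : cyc3 b d a = [~ cyc3 a e b, cyc3 b d f].
  have [] // := @commg_cyc3 (cyc3 a e b) (cyc3 b d f) b.
  - move=> s; rewrite !cyc3E //.
    case: (eqVneq s a) => [->|_]; first by rewrite ab ad (eq_sym a f) (negPf fa) eqxx.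
    case: (eqVneq s e) => [->|_]; first by rewrite eb (negPf ed) (eq_sym e f) (negPf fe) eqxx.
    by case: (eqVneq s b) => [->|_]; rewrite ?eqxx.
  - by rewrite cyc3E // eqxx (eq_sym b a) ab (eq_sym b e) eb ab.
  - by rewrite cyc3E // eqxx eq_sym bd.
  - by move=> _ ->; rewrite !cyc3E // !eqxx (eq_sym b a) ab (eq_sym b e) eb.
by rewrite groupR.
Qed.

(* The 3-cycles are closed under conjugation, so simplicity of the alternating
   group forces them to generate it. *)
Lemma Alt_sub_linked : 4 < #|T| -> (forall a b, linked a b) -> 'Alt_T \subset H.
Proof.
move=> T5 tot; pose cycs := [set p : {perm T} | [exists a : T, exists b : T, exists d : T,
  uniq [:: a; b; d] && (p == cyc3 a b d)]].
have cycsP p : reflect (exists a b d, uniq [:: a; b; d] /\ p = cyc3 a b d) (p \in cycs).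
  rewrite inE; apply: (iffP existsP) => [[a /existsP[b /existsP[d /andP[U /eqP->]]]]|].
    by exists a, b, d.
  case=> a [b [d [U ->]]]; exists a; apply/existsP; exists b; apply/existsP; exists d.
  by rewrite U eqxx.
have cycsA : <<cycs>> \subset 'Alt_T.
  by rewrite gen_subG; apply/subsetP=> p /cycsP[a [b [d [U ->]]]]; apply: cyc3_even.
have cycsN : <<cycs>> <| 'Alt_T.
  rewrite /normal cycsA norms_gen //; apply/subsetP=> q _.
  apply/normP/setP=> p; rewrite mem_conjg; apply/cycsP/cycsP=> [] [a [b [d [U E]]]].
    exists (q a), (q b), (q d); split; last by rewrite -cyc3J -E conjgKV.
    by rewrite -[[:: _; _; _]]/(map q [:: a; b; d]) map_inj_uniq //; apply: perm_inj.
  exists (q^-1 a), (q^-1 b), (q^-1 d); split; last by rewrite E cyc3J.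
  by rewrite -[[:: _; _; _]]/(map _ [:: a; b; d]) map_inj_uniq //; apply: perm_inj.
have [_ sim] := simpleP _ (simple_Alt5 T5).
have [/eqP|<-] := sim <<cycs>>%G cycsN; last first.
  by rewrite gen_subG; apply/subsetP=> p /cycsP[a [b [d [U ->]]]]; apply: linked_cyc3.
have [a [b [d U]]] : exists a b d : T, uniq [:: a; b; d].
  have := enum_uniq T; have : size (enum T) = #|T| by rewrite cardE.
  case: (enum T) => [|a [|b [|d l]]] Es; rewrite -Es // in T5 *.
  move=> Ul; exists a, b, d; move: Ul; rewrite -[_ :: _]/([:: a; b; d] ++ l) cat_uniq.
  by case/andP.
move=> E1; have : cyc3 a b d \in <<cycs>>.
  by apply: mem_gen; apply/cycsP; exists a, b, d.
rewrite (eqP E1) inE => /eqP/permP/(_ a); rewrite cyc3E // eqxx perm1 => ba.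
by move: U; rewrite ba /= mem_head.
Qed.

End Generation.

(** * A criterion for Hurwitz generation of the alternating group *)

Section Criterion.
Variables x y : {perm T}.
Let w := x * y * x * y^-1.
Let z := (x * y)^-1.
Let H := <<[set x; y; z]>>%G.

Hypothesis x2 : x ^+ 2 = 1.
Hypothesis y3 : y ^+ 3 = 1.
Hypothesis z7 : z ^+ 7 = 1.
Hypothesis xy_trans : forall B : T -> Prop, (forall s, B s -> B (x s)) ->
  (forall s, B s -> B (y s)) -> forall s t, B s -> B t.

Variables (C : pred T) (L : nat) (a b : T).
Hypothesis C7 : forall s, C s -> (w ^+ 7) s = s.
Hypothesis C_mv : forall s, C s -> w s != s.
Hypothesis C_trans : forall s t, C s -> C t -> exists m, t = (w ^+ m) s.
Hypothesis L7 : coprime 7 L.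
Hypothesis fixL : forall s, ~~ C s -> (w ^+ L) s = s.
Hypotheses (Ca : C a) (Cxa : C (x a)) (Cb : C b) (Cyb : C (y b)).
Hypothesis b_uniq : forall s, C s -> C (y s) -> s = b.

Lemma xyH : [/\ x \in H, y \in H & z \in H].
Proof. by split; apply: mem_gen; rewrite !inE eqxx ?orbT. Qed.

Lemma expw_mod7 s n : C s -> (w ^+ n) s = (w ^+ (n %% 7)) s.
Proof.
move=> Cs; rewrite {1}(divn_eq n 7) expgD permM mulnC expgM; congr ((w ^+ _) _).
by elim: (n %/ 7) => [|k IH]; rewrite ?perm1 // expgS permM C7.
Qed.

(** On the 7-cycle exponents matter modulo 7, and [L ^ 6] is 1 modulo 7 by Euler's theorem. *)
Lemma expL_w s : C s -> (w ^+ L ^+ (L ^ 5)) s = w s.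
Proof.
move=> Cs; rewrite -expgM expw_mod7 // -expnS.
by rewrite (@Euler_exp_totient L 7) // coprime_sym.
Qed.

Lemma expL_mv s : ((w ^+ L) s != s) = C s.
Proof.
apply/idP/idP => [|Cs]; first by apply: contraR => /fixL->.
apply: contra_neq (C_mv Cs) => E; rewrite -(expL_w Cs).
by elim: (L ^ 5)%N => [|k IH]; rewrite ?perm1 // expgS permM E.
Qed.

Lemma xyH_linked : forall s t, linked H s t.
Proof.
have [Hx Hy _] := xyH.
have Hw : w \in H by rewrite !groupM ?groupV.
have Hu : w ^+ L \in H by rewrite groupX.
(* The conjugate of [w ^+ L] by [y] moves exactly the image of [C] under [y], which meets [C] only
   in [y b]. *)
pose t := y b.
have [|||U E] := @commg_cyc3 (w ^+ L) ((w ^+ L) ^ y) t.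
- move=> s; rewrite expL_mv conjgE !permM => Cs.
  rewrite -{2}(permKV y s) (inj_eq perm_inj) expL_mv => Cys.
  by rewrite /t -(b_uniq Cys) ?permKV.
- by rewrite expL_mv.
- by rewrite permJ (inj_eq perm_inj) expL_mv.
have tu : linked H t ((w ^+ L) t).
  right; exists (((w ^+ L) ^ y) t); first by rewrite uniq3CA.
  by rewrite -cyc3V -E groupV groupR // groupJ.
have tuk k : linked H t ((w ^+ L ^+ k) t).
  elim: k => [|k IH]; first by left; rewrite perm1.
  apply: linked_trans tu _; rewrite expgSr permM.
  exact: linked_act Hu IH.
have tw m : linked H t ((w ^+ m) t).
  elim: m => [|m IH]; first by left; rewrite perm1.
  apply: (@linked_trans _ _ (w t)); first by rewrite -(expL_w Cyb).
  by rewrite expgSr (permM (w ^+ m)); exact: linked_act Hw IH.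
have tC s : C s -> linked H t s by move=> Cs; have [m ->] := C_trans Cyb Cs.
suff tall s : linked H t s by move=> s s'; apply: linked_trans (linked_sym (tall s)) _.
apply: xy_trans (t) s _; last by left.
  move=> s ts; apply: linked_trans (tC _ Cxa) (linked_act Hx _).
  exact: linked_trans (linked_sym (tC _ Ca)) ts.
move=> s ts; apply: linked_trans (tC _ Cyb) (linked_act Hy _).
exact: linked_trans (linked_sym (tC _ Cb)) ts.
Qed.

Lemma xyH_Alt : 4 < #|T| -> H = 'Alt_T :> {set _}.
Proof.
move=> T5; apply/eqP; rewrite eqEsubset (Alt_sub_linked T5 xyH_linked) andbT.
have odd_exp p k : p ^+ k = 1 -> odd k -> p \in 'Alt_T.
  move=> E ok; have oddX : odd_perm (p ^+ k) = odd k && odd_perm p.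
    elim: k {E ok} => [|k IH]; first by rewrite odd_perm1.
    by rewrite expgS odd_permM IH /=; case: (odd k); case: (odd_perm p).
  by rewrite Alt_even; move: oddX; rewrite E odd_perm1 ok /= => <-.
have Ay : y \in 'Alt_T by exact: odd_exp y3 _.
have Az : z \in 'Alt_T by exact: odd_exp z7 _.
have Ax : x \in 'Alt_T.
  by rewrite -(mulgK y x) groupM ?groupV // -(invgK (x * y)) groupV.
by rewrite gen_subG; apply/subsetP=> p /setUP[/set2P[]|/set1P] ->.
Qed.

Lemma xyH_hurwitz : 4 < #|T| -> hurwitz_triple ('Alt_T)%G x y z.
Proof.
move=> T5; have HA := xyH_Alt T5.
have [Hx Hy Hz] := xyH.
have w1 : w != 1 by apply: contraNneq (C_mv Ca) => ->; rewrite perm1.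
have y1 : y != 1.
  by apply: contra_neq w1; rewrite /w => ->; rewrite invg1 !mulg1; exact: x2.
have x1 : x != 1.
  by apply: contra_neq w1; rewrite /w => ->; rewrite !mulg1 !mul1g mulgV.
have z1 : z != 1.
  apply: contra_neq y1 => /eqP; rewrite eq_invg1 -eq_invg_mul => /eqP xV.
  have yx : y = x by rewrite -xV; apply/eqP; rewrite eq_invg_mul -x2.
  by rewrite -y3 expgS {3}yx x2 mulg1.
have -> : ('Alt_T)%G = H by apply: group_inj.
split; first by split.
by split; rewrite ?(nt_prime_order _ x2) ?(nt_prime_order _ y3) ?(nt_prime_order _ z7) ?mulgV.
Qed.

End Criterion.

(** * Fixed points and conjugate powers *)

Definition nfix p := #|[pred s | p s == s]|.

(** For prime order, [p] is in turn a power of [p ^+ i]. *)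
Lemma nfix_expg p i : prime #[p] -> p ^+ i != 1 -> nfix (p ^+ i) = nfix p.
Proof.
move=> pr pi1; apply: eq_card => s; rewrite !inE.
have fixX q k : q s = s -> (q ^+ k) s = s.
  by move=> E; elim: k => [|k IH]; rewrite ?perm1 // expgS permM E.
apply/eqP/eqP=> [E|/fixX//].
have /cycleP[k ->] : p \in <[p ^+ i]>; last exact: fixX.
have /eqP <- : generator <[p]> (p ^+ i); last exact: cycle_id.
by rewrite generator_coprime prime_coprime // order_dvdn.
Qed.

Lemma order_expg_prime (gT : finGroupType) (g : gT) i :
  prime #[g] -> g ^+ i != 1 -> #[g ^+ i] = #[g].
Proof. by move=> pr; apply: nt_prime_order; rewrite // -expgM mulnC expgM expg_order expg1n. Qed.

Lemma nfixJ p q : nfix (p ^ q) = nfix p.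
Proof.
rewrite /nfix -(card_image (@perm_inj _ q) [pred t | p t == t]); apply: eq_card => s; rewrite inE.
apply/eqP/imageP=> [E|[t /eqP E ->]]; last by rewrite permJ E.
exists (q^-1 s); last by rewrite permKV.
by rewrite inE -(inj_eq (@perm_inj _ q)) -permJ permKV E.
Qed.

Lemma no_conjugate_powers_nfix (G : {group {perm T}}) p q :
  prime #[p] -> prime #[q] -> (#[p] = #[q] -> nfix p <> nfix q) ->
  no_conjugate_powers G p q.
Proof.
move=> prp prq neq i j pi1 [g _ E].
have qj1 : q ^+ j != 1 by rewrite -E conjg_eq1.
apply: neq; last by rewrite -(nfix_expg prq qj1) -E nfixJ nfix_expg.
by rewrite -(order_expg_prime prp pi1) -(order_expg_prime prq qj1) -E orderJ.
Qed.

Lemma dHB_nfix (G : {group {perm T}}) x1 y1 z1 x2 y2 z2 :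
  hurwitz_triple G x1 y1 z1 -> hurwitz_triple G x2 y2 z2 ->
  nfix x1 <> nfix x2 -> nfix y1 <> nfix y2 -> nfix z1 <> nfix z2 -> dHB_group G.
Proof.
move=> H1 H2 nx ny nz; exists x1, y1, z1, x2, y2, z2; split=> // p q.
have [_ [ox1 oy1 oz1 _ _]] := H1; have [_ [ox2 oy2 oz2 _ _]] := H2.
rewrite !inE -!orbA => /or3P[]/eqP-> /or3P[]/eqP->;
  by apply: no_conjugate_powers_nfix; rewrite ?ox1 ?oy1 ?oz1 ?ox2 ?oy2 ?oz2.
Qed.
End ThreeCycles.

(** * Chains of coset diagrams *)

(* A coset diagram of <x, y | x^2 = y^3 = (xy)^7 = 1> on 0 .. deg - 1.  [x_table] lists the values
   of x; y cycles the first [y_triples] blocks (3i, 3i+1, 3i+2) and fixes the later points.  The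
   pairs (0, 1) and (right_handle, right_handle + 1) are (1)-handles: points a, a y fixed by x.
   Two diagrams are joined by letting x exchange such pairs, which preserves (xy)^7 = 1.
   [marked] is either empty or the 7-cycle of x y x y^-1 mentioned at the top. *)
Record piece := Piece {x_table : seq nat; y_triples : nat; right_handle : nat; marked : seq nat}.

Definition deg p := size (x_table p).

Definition piece_y p j :=
  if j < 3 * y_triples p then if j %% 3 == 2 then j.-2 else j.+1 else j.

Definition piece0 := Piece [::] 0 0 [::].

(* x on the diagram chained from [W], a point being a pair (piece, point of the piece).  A set flag
   [oL] (resp. [oR]) says that [W] may continue to the left (resp. right), in which case the value
   of x on the outer handle is unknown. *)
Definition step_x (oL oR : bool) (W : seq piece) (q : nat * nat) : option (nat * nat) :=
  let: (i, j) := q in let p := nth piece0 W i in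
  if (right_handle p <= j < right_handle p + 2) && ((i.+1 < size W) || oR) then
    if i.+1 < size W then Some (i.+1, j - right_handle p) else None
  else if (j < 2) && ((0 < i) || oL) then
    if 0 < i then Some (i.-1, right_handle (nth piece0 W i.-1) + j) else None
  else Some (i, nth 0 (x_table p) j).

Definition step_y (W : seq piece) (q : nat * nat) := (q.1, piece_y (nth piece0 W q.1) q.2).

Definition walk oL oR W (v : seq bool) (q : nat * nat) :=
  foldl (fun o b => if b then obind (step_x oL oR W) o else omap (step_y W) o) (Some q) v.

(* Words act from left to right, [true] standing for x and [false] for y; y^-1 = y y. *)
Definition comm_word := [:: true; false; true; false; false].
Definition xy7_word := flatten (nseq 7 [:: true; false]).

(** With both flags unset [step_x] always has a value, so the default is never taken. *)
Definition chain_x c q := odflt q (step_x false false c q).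
Definition chain_word c (v : seq bool) q :=
  foldl (fun r (b : bool) => if b then chain_x c r else step_y c r) q v.

Definition shift k (q : nat * nat) := (k + q.1, q.2).

(** * Walks in a window agree with walks in the chain *)

Section Locality.
Variables (c1 W c2 : seq piece) (oL oR : bool).
Hypotheses (hL : oL || nilp c1) (hR : oR || nilp c2).
Let c := c1 ++ W ++ c2.

Lemma nth_window i : i < size W -> nth piece0 c (size c1 + i) = nth piece0 W i.
Proof. by move=> iW; rewrite !nth_cat ltnNge leq_addr addKn /= iW. Qed.

(** The window lacks the value of [x] only on an outer handle with its flag set, where [step_x]
    gives [None]. An unset flag forces the whole chain to end there, so both evaluations proceed
    alike. *)
Lemma chain_x_local q q' : q.1 < size W -> step_x oL oR W q = Some q' ->
  chain_x c (shift (size c1) q) = shift (size c1) q' /\ q'.1 < size W.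
Proof.
case: q => i j /= iW; rewrite /chain_x /step_x /= nth_window //.
have -> : (size c1 + i).+1 < size c = (i.+1 < size W) || ~~ nilp c2.
  rewrite /c !size_cat -addnS ltn_add2l /nilp; case: (ltngtP i.+1 (size W)) iW => //= [lt|->] _.
    by rewrite ltn_addr.
  by rewrite -{1}[size W]addn0 ltn_add2l lt0n.
case: ifP => [/andP[-> /=]|].
  by case: ltnP => //= lt _ [<-]; rewrite /shift /= addnS.
move=> E; have -> : (right_handle (nth piece0 W i) <= j < right_handle (nth piece0 W i) + 2) &&
    ((i.+1 < size W) || ~~ nilp c2 || false) = false.
  move/negbT: E; rewrite negb_and => /orP[/negPf->//|]; rewrite negb_or orbF => /andP[/negPf-> oRF].
  by move: hR; rewrite (negPf oRF) /= => ->; rewrite andbF.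
rewrite orbF addn_gt0; case: i iW E => [|i] iW E /=; last first.
  rewrite orbT andbT /=; case: ifP => _ [<-] /=; rewrite /shift /=; last by [].
  by rewrite addnS /= nth_window ?(ltnW iW).
rewrite /= orbF addn0; case: ifP => //= + [<-].
move/negbT; rewrite negb_and => /orP[/negPf->|oLF] /=; first by rewrite /shift /= addn0.
by move: hL; rewrite (negPf oLF) /nilp /= => /eqP->; rewrite andbF.
Qed.

Lemma step_y_local q : q.1 < size W ->
  step_y c (shift (size c1) q) = shift (size c1) (step_y W q).
Proof. by case: q => i j /= iW; rewrite /step_y /shift /= nth_window. Qed.

Lemma chain_word_local v q q' : q.1 < size W -> walk oL oR W v q = Some q' ->
  chain_word c v (shift (size c1) q) = shift (size c1) q' /\ q'.1 < size W.
Proof.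
rewrite /walk /chain_word; elim: v q => [|b v IH] q qW /=; first by case=> <-.
case: b => /=; last by rewrite step_y_local //; apply: IH.
case E: step_x => [q1|] /=; last first.
  by have -> : foldl (fun o (b : bool) => if b then obind (step_x oL oR W) o else omap (step_y W) o)
    None v = None by elim: v {IH} => // -[].
by have [-> q1W] := chain_x_local qW E; apply: IH.
Qed.

End Locality.

(** * Checking a chain on its windows *)

Definition oseq (T : Type) (o : option T) : seq T := if o is Some a then [:: a] else [::].

(** Every entry together with its two neighbours; [None] marks an end of the chain and later leaves
    the corresponding flag of [step_x] unset. *)
Fixpoint triples (T : Type) (prev : option T) (s : seq T) : seq (option T * T * option T) :=
  if s is a :: s' then (prev, a, ohead s') :: triples (Some a) s' else [::].

Lemma size_triples T prev (s : seq T) : size (triples prev s) = size s.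
Proof. by elim: s prev => //= a s IH prev; rewrite IH. Qed.

Lemma triples_window (T : Type) (t0 : option T * T * option T) prev (s : seq T) i :
  i < size s -> let: (l, a, r) := nth t0 (triples prev s) i in
  exists c1 c2, [/\ oseq prev ++ s = c1 ++ (oseq l ++ a :: oseq r) ++ c2,
    i + size (oseq prev) = size c1 + size (oseq l), isSome l || nilp c1 & isSome r || nilp c2].
Proof.
elim: s prev i => // b s IH prev [|i] /= lt.
  exists [::], (behead s); rewrite orbT /=; split=> //; first by rewrite -catA /=; case: s {IH lt}.
  by case: s {IH lt}.
have := IH (Some b) i lt; case: (nth _ _ _) => [[l a] r] /= [c1 [c2 [E1 E2 h1 h2]]].
exists (oseq prev ++ c1), c2; split=> //; first by rewrite -catA -E1.
  by rewrite size_cat -addnA -E2 addn1 addnC.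
case: l E2 h1 {E1} => //= E2 /eqP c10; move: E2; rewrite c10 addn1 //.
Qed.

(** [k] numbers the step about to be taken. Leaving the window or exhausting the fuel counts as
    failure, so success certifies a cycle length prime to 7. *)
Fixpoint returns_coprime7 (f : nat * nat -> option (nat * nat)) fuel k q0 q :=
  if fuel is m.+1 then
    if f q is Some q' then if q' == q0 then ~~ (7 %| k) else returns_coprime7 f m k.+1 q0 q'
    else false
  else false.

Definition window (t : option piece * piece * option piece) :=
  let: (l, a, r) := t in oseq l ++ a :: oseq r.
Definition window_walk (t : option piece * piece * option piece) :=
  walk (isSome t.1.1) (isSome t.2) (window t).
Definition window_pt (t : option piece * piece * option piece) (j : nat) := (size (oseq t.1.1), j).

(* As all relevant cycles stay within a piece and its two neighbours, a chain is checked on its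
   windows of three consecutive pieces. *)
Definition triple_ok (t : option piece * piece * option piece) :=
  let a := t.1.2 in (isSome t.2 ==> (right_handle a < deg a)) &&
  all (fun j => [&& if window_walk t [:: true] (window_pt t j) is Some q then
                      (q.2 < deg (nth piece0 (window t) q.1)) &&
                      (window_walk t [:: true] q == Some (window_pt t j))
                    else false,
                    piece_y a j < deg a, piece_y a (piece_y a (piece_y a j)) == j,
                    window_walk t xy7_word (window_pt t j) == Some (window_pt t j)
                  & (j \in marked a) ||
                      returns_coprime7 (window_walk t comm_word) 130 1 (window_pt t j) (window_pt t j)])
    (iota 0 (deg a)).

Definition piece_walk p := walk true true [:: p].

(* The second disjunct of the first test makes every point connected to a smaller one, hence
   to 0, without using x on a handle. *)
Definition piece_ok p :=
  [&& all (fun j => (piece_y p j.-1 == j) ||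
        (if piece_walk p [:: true] (0, j) is Some q then (q.1 == 0) && (q.2 < j) else false))
        (iota 1 (deg p).-1)
    & (marked p == [::]) ||
      [&& size (marked p) == 7, uniq (marked p), all (fun j => j < deg p) (marked p),
          all (fun k => piece_walk p comm_word (0, nth 0 (marked p) k)
                        == Some (0, nth 0 (marked p) (k.+1 %% 7))) (iota 0 7),
          size [seq j <- marked p | piece_y p j \in marked p] == 1
        & has (fun j => if piece_walk p [:: true] (0, j) is Some q
                        then (q.1 == 0) && (q.2 \in marked p) else false) (marked p)]].

Definition good_chain c :=
  [&& all triple_ok (triples None c), all piece_ok c & count (fun p => marked p != [::]) c == 1].

Definition tsum (f : option piece * piece * option piece -> nat) c :=
  sumn (map f (triples None c)).
Definition fixed_by v (t : option piece * piece * option piece) :=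
  count (fun j => window_walk t v (window_pt t j) == Some (window_pt t j)) (iota 0 (deg t.1.2)).

Definition valid c (q : nat * nat) := (q.1 < size c) && (q.2 < deg (nth piece0 c q.1)).

Lemma count1_nth (T : Type) (a : pred T) x0 s : count a s = 1 ->
  exists2 i, i < size s & forall j, j < size s -> a (nth x0 s j) = (j == i).
Proof.
elim: s => //= b s IH; case ab: (a b) => /=.
  rewrite add1n => -[/eqP]; rewrite -leqn0 leqNgt -has_count -all_predC => /all_nthP s0.
  exists 0 => // -[|j] //= js; exact/negbTE/s0.
rewrite add0n => /IH[i lt iE]; exists i.+1 => // -[|j] //= js; exact: iE.
Qed.

(** * From window checks to the whole chain *)

Section Chain.
Variable c : seq piece.

Let t0 : option piece * piece * option piece := (None, piece0, None).

Lemma chain_local q : valid c q ->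
  let t := nth t0 (triples None c) q.1 in
  t.1.2 = nth piece0 c q.1 /\ exists k,
    q = shift k (window_pt t q.2) /\ (window_pt t q.2).1 < size (window t) /\
    forall v q1 q2, q1.1 < size (window t) -> window_walk t v q1 = Some q2 ->
      [/\ chain_word c v (shift k q1) = shift k q2, q2.1 < size (window t) &
          valid c (shift k q2) = (q2.2 < deg (nth piece0 (window t) q2.1))].
Proof.
case: q => i j /andP[/= ic jd].
have := triples_window t0 None ic; case E : (nth _ _ _) => [[l a] r] /=.
case=> c1 [c2 [Ec Ei h1 h2]]; rewrite addn0 in Ei.
have la : size (oseq l) < size (oseq l ++ a :: oseq r) by rewrite size_cat /= addnS ltnS leq_addr.
split; first by rewrite Ec Ei nth_window // nth_cat ltnn subnn.
exists (size c1); split; first by rewrite /shift /window_pt /= Ei.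
split=> // v q1 q2 q1W E12.
have := chain_word_local h1 h2 q1W E12; rewrite -Ec => -[-> q2W]; split=> //.
by rewrite /valid /= Ec nth_window // size_cat ltn_add2l size_cat ltn_addr.
Qed.

Hypothesis cT : all triple_ok (triples None c).

Lemma triple_okP q : valid c q -> let t := nth t0 (triples None c) q.1 in
  [/\ exists q1, [/\ window_walk t [:: true] (window_pt t q.2) = Some q1,
        q1.2 < deg (nth piece0 (window t) q1.1) &
        window_walk t [:: true] q1 = Some (window_pt t q.2)],
      piece_y t.1.2 q.2 < deg t.1.2, piece_y t.1.2 (piece_y t.1.2 (piece_y t.1.2 q.2)) = q.2,
      window_walk t xy7_word (window_pt t q.2) = Some (window_pt t q.2) &
      (q.2 \in marked t.1.2) ||
        returns_coprime7 (window_walk t comm_word) 130 1 (window_pt t q.2) (window_pt t q.2)].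
Proof.
move=> vq t; have [Et _] := chain_local vq; move: vq => /andP[iq jq].
have /(all_nthP t0)/(_ q.1) := cT; rewrite size_triples iq -/t => /(_ isT) /andP[_ /allP/(_ q.2)].
rewrite mem_iota add0n leq0n -/t; rewrite -/t in Et; rewrite Et jq => /(_ isT) /and5P[].
case E: (window_walk t [:: true] _) => [q1|//] /andP[d1 /eqP E1] h1 /eqP h2 /eqP h3 h4.
by split=> //; exists q1.
Qed.

Lemma right_handle_deg i : i.+1 < size c -> right_handle (nth piece0 c i) < deg (nth piece0 c i).
Proof.
move=> ic; have ic' := ltnW ic; have := triples_window t0 None ic'.
have /(all_nthP t0)/(_ i) := cT; rewrite size_triples ic' => /(_ isT) /andP[+ _].
case: (nth t0 _ i) => [[l a] r] /implyP /= hr [c1 [c2 [Ec Ei _ h2]]]; rewrite addn0 in Ei.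
have -> : nth piece0 c i = a.
  by rewrite Ec Ei nth_window ?nth_cat ?ltnn ?subnn // size_cat /= addnS ltnS leq_addr.
apply: hr; case: r h2 Ec => //= /nilP -> Ec; move: ic.
by rewrite Ec Ei !size_cat /= addn0 addn1 addnS ltnn.
Qed.

Lemma chain_x_valid q : valid c q -> valid c (chain_x c q) /\ chain_x c (chain_x c q) = q.
Proof.
move=> vq; have [[q1 [E1 d1 E2]] _ _ _ _] := triple_okP vq.
have [_ [k [Eq [lt loc]]]] := chain_local vq.
have [F1 l1 v1] := loc _ _ _ lt E1; have [F2 _ _] := loc _ _ _ l1 E2.
have -> : chain_x c q = shift k q1 by rewrite -F1 -Eq.
by rewrite v1 d1; split=> //; rewrite [RHS]Eq -F2.
Qed.

Lemma step_y_valid q : valid c q ->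
  valid c (step_y c q) /\ step_y c (step_y c (step_y c q)) = q.
Proof.
move=> vq; have [_ d h _ _] := triple_okP vq; have [Et _] := chain_local vq.
case: q vq Et d h => i j /andP[/= ic jd] /= -> d h.
by rewrite /valid /step_y /= ic d h.
Qed.

Lemma chain_word_xy7 q : valid c q -> chain_word c xy7_word q = q.
Proof.
move=> vq; have [_ _ _ E _] := triple_okP vq; have [_ [k [Eq [lt loc]]]] := chain_local vq.
by have [F _ _] := loc _ _ _ lt E; rewrite [RHS]Eq -F -Eq.
Qed.

Definition marked_pt q := valid c q && (q.2 \in marked (nth piece0 c q.1)).

Lemma comm_word_return q : valid c q -> ~~ marked_pt q ->
  exists k, [/\ 0 < k < 200, ~~ (7 %| k) & iter k (chain_word c comm_word) q = q].
Proof.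
move=> vq nsp; have [_ _ _ _] := triple_okP vq; have [Et [k [Eq [lt loc]]]] := chain_local vq.
rewrite Et (negPf (_ : q.2 \notin _)) /=; last by move: nsp; rewrite /marked_pt vq.
set t := nth _ _ _ in Eq lt loc *; set q0 := window_pt t q.2 in Eq *.
(* Fuel and step number add up to at most 131, so every certified return time stays below the bound
   200 used for the exponent [L]. *)
have step m q2 : q2.1 < size (window t) -> forall fuel, fuel + m <= 131 -> 0 < m ->
    iter m.-1 (chain_word c comm_word) q = shift k q2 ->
    returns_coprime7 (window_walk t comm_word) fuel m q0 q2 ->
    exists k, [/\ 0 < k < 200, ~~ (7 %| k) & iter k (chain_word c comm_word) q = q].
  move=> + fuel; elim: fuel m q2 => //= fuel IH m q2 l2 lem m0 Em.
  case E: (window_walk _ _ _) => [q3|//]; have [F l3 _] := loc _ _ _ l2 E.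
  have Em' : iter m (chain_word c comm_word) q = shift k q3 by rewrite -(prednK m0) iterS Em.
  case: eqP => [q30 h7|_]; last by apply: (IH m.+1) => //; rewrite addnS -addSn.
  exists m; split=> //; last by rewrite Em' q30.
  rewrite m0 /=; apply: leq_trans (_ : 132 <= 200) => //; rewrite ltnS.
  by apply: leq_trans lem; rewrite leq_addl.
by apply: (step 1 q0 lt 130).
Qed.
End Chain.

(** * Permutations of an enumerated set *)

Section Enumeration.
Variables (Q : eqType) (q0 : Q) (s : seq Q) (us : uniq s).

Definition enum_pt (k : 'I_(size s)) := nth q0 s k.

Lemma pt_inj : injective enum_pt.
Proof. by move=> k l /eqP; rewrite nth_uniq // => /eqP/ord_inj. Qed.

Lemma pt_mem k : enum_pt k \in s. Proof. exact: mem_nth. Qed.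

Lemma pt_onto q : q \in s -> exists k, enum_pt k = q.
Proof.
by rewrite -index_mem => qs; exists (Ordinal qs); rewrite /enum_pt nth_index // -index_mem.
Qed.

Lemma perm_of_map (F : Q -> Q) : {in s, forall q, F q \in s} -> {in s &, injective F} ->
  exists p : {perm 'I_(size s)}, forall k, enum_pt (p k) = F (enum_pt k).
Proof.
(* The default [k] is never reached, as [F] maps [s] into itself. *)
move=> sF iF; pose h k := insubd k (index (F (enum_pt k)) s) : 'I_(size s).
have hE k : enum_pt (h k) = F (enum_pt k).
  have Fs := sF _ (pt_mem k); rewrite /enum_pt /h val_insubd index_mem Fs.
  exact: nth_index.
have hI : injective h by move=> k l E; apply: pt_inj; apply: iF; rewrite ?pt_mem // -!hE E.
by exists (perm hI) => k; rewrite permE.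
Qed.

Lemma nfix_count (F : Q -> Q) (p : {perm 'I_(size s)}) :
  (forall k, enum_pt (p k) = F (enum_pt k)) ->
  nfix p = count (fun q => F q == q) s.
Proof.
move=> pE; have Es : s = map enum_pt (enum 'I_(size s)).
  by rewrite (map_comp (nth q0 s) val) val_enum_ord -/(mkseq _ _) mkseq_nth.
rewrite [in RHS]Es count_map /nfix cardE size_filter enumT; apply: eq_count => k.
by rewrite !inE /= -pE (inj_eq pt_inj).
Qed.
End Enumeration.

(** * Points of a chain and its connectedness *)

Definition points c := [seq (i, j) | i <- iota 0 (size c), j <- iota 0 (deg (nth piece0 c i))].

Lemma mem_points c q : (q \in points c) = valid c q.
Proof.
case: q => i j; apply/allpairsPdep/andP => /= [[k [l []]]|[ic jd]].
  by rewrite !mem_iota /= !add0n => kc ld [-> ->].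
by exists i, j; rewrite !mem_iota.
Qed.

Lemma uniq_points c : uniq (points c).
Proof.
apply: allpairs_uniq_dep => [|i _|]; rewrite ?iota_uniq //.
by move=> [i1 j1] [i2 j2] _ _ /= [-> ->].
Qed.

Lemma size_points c : size (points c) = sumn (map deg c).
Proof.
rewrite size_allpairs_dep -[in RHS](mkseq_nth piece0 c) /mkseq -map_comp.
by congr sumn; apply: eq_map => i; rewrite /= size_iota.
Qed.

Section Chain.
Variable c : seq piece.
Let t0 : option piece * piece * option piece := (None, piece0, None).
Hypothesis cT : all triple_ok (triples None c).
Hypothesis cP : all piece_ok c.
Hypothesis cS : count (fun p => marked p != [::]) c = 1.

Lemma piece_walk_local i j v q : i < size c -> piece_walk (nth piece0 c i) v (0, j) = Some q ->
  chain_word c v (i, j) = (i, q.2).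
Proof.
move=> ic E; have Ec : c = take i c ++ [:: nth piece0 c i] ++ drop i.+1 c.
  by rewrite cat1s -drop_nth // cat_take_drop.
have := @chain_word_local (take i c) [:: nth piece0 c i] (drop i.+1 c) true true isT isT v
  (0, j) q isT E.
rewrite -Ec /shift /= size_takel ?(ltnW ic) // addn0 => -[-> ]; rewrite ltnS leqn0 => /eqP->.
by rewrite addn0.
Qed.

Lemma piece_okP i : i < size c -> let p := nth piece0 c i in
  [/\ forall j, 0 < j < deg p -> piece_y p j.-1 = j \/
    exists2 k, k < j & chain_x c (i, j) = (i, k)
    & marked p != [::] ->
      [/\ size (marked p) = 7 /\ uniq (marked p), forall j, j \in marked p -> j < deg p,
        forall k, k < 7 ->
          chain_word c comm_word (i, nth 0 (marked p) k) = (i, nth 0 (marked p) (k.+1 %% 7)),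
        exists b, [seq j <- marked p | piece_y p j \in marked p] = [:: b]
      & exists2 a, a \in marked p & exists2 a', a' \in marked p & chain_x c (i, a) = (i, a')]].
Proof.
move=> ic p; have /(all_nthP piece0)/(_ i ic) := cP; rewrite -/p => /andP[/allP h2 h3].
split=> // [j /andP[j0 jd]|sp].
  have d0 : 0 < deg p by apply: leq_trans jd.
  have := h2 j; rewrite mem_iota j0 add1n (prednK d0) jd => /(_ isT).
  case/orP=> [/eqP->|]; first by left.
  case E: piece_walk => [q|//] /andP[_ lt]; right; exists q.2 => //.
  exact: (piece_walk_local ic E).
move: h3; rewrite (negPf sp) orFb.
case/and5P=> [/eqP h4 h5 /allP h6 /allP h7 /andP[/eqP h8 /hasP[a asp h9]]].
split=> //.
- move=> k k7; have := h7 k; rewrite mem_iota k7 => /(_ isT) /eqP E.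
  exact: (piece_walk_local ic E).
- by case: filter h8 => // b [|//] _; exists b.
exists a => //; case E: piece_walk h9 => [q|//] /andP[_ q2]; exists q.2 => //.
exact: (piece_walk_local ic E).
Qed.

Lemma shift_inj k : injective (shift k).
Proof. by move=> [i j] [i' j'] [] /addnI -> ->. Qed.

(** Each point is tested in the window of its own piece. The walks must be defined, for an undefined
    one would hide a fixed point. *)
Lemma count_points v : (forall q, valid c q -> exists q1,
    window_walk (nth t0 (triples None c) q.1) v
      (window_pt (nth t0 (triples None c) q.1) q.2) = Some q1) ->
  count (fun q => chain_word c v q == q) (points c) = tsum (fixed_by v) c.
Proof.
move=> tot; rewrite /points /allpairs_dep count_flatten -map_comp /tsum.
rewrite -[triples None c](mkseq_nth t0) /mkseq -map_comp size_triples.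
congr sumn; apply/eq_in_map => i; rewrite mem_iota add0n => /andP[_ ic].
rewrite /= count_map /fixed_by; set t := nth t0 _ _.
have Et : t.1.2 = nth piece0 c i.
  have := triples_window t0 None ic; rewrite -/t; case: t => [[l a] r] /=.
  case=> c1 [c2 [Ec Ei _ _]]; rewrite addn0 in Ei.
  by rewrite Ec Ei nth_window ?nth_cat ?ltnn ?subnn // size_cat /= addnS ltnS leq_addr.
rewrite Et; apply: eq_in_count => j; rewrite mem_iota add0n => /andP[_ jd]; rewrite /=.
have vij : valid c (i, j) by apply/andP.
have [q1 E] := tot _ vij; have [_ [k [Eq [lt loc]]]] := chain_local vij.
have [F _ _] := loc _ _ _ lt E.
rewrite [window_walk _ _ _]E.
have -> : (chain_word c v (i, j) == (i, j)) = (shift k q1 == shift k (window_pt t j)).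
  by rewrite -F -Eq.
by rewrite (inj_eq (@shift_inj k)).
Qed.

Lemma chain_x_joint i : i.+1 < size c -> chain_x c (i, right_handle (nth piece0 c i)) = (i.+1, 0).
Proof. by move=> ic; rewrite /chain_x /step_x leqnn -addn1 leq_add2l /= addn1 ic /= subnn. Qed.

(** As [x] and [y] have finite order, closure under them works in both directions. Within a piece
    each point is joined to a smaller one, hence to 0, and point 0 of the next piece is the image
    under [x] of the right handle, so every point is joined to [(0, 0)]. *)
Lemma chain_ind (D : nat * nat -> Prop) :
  (forall q, valid c q -> D q -> D (chain_x c q)) ->
  (forall q, valid c q -> D q -> D (step_y c q)) ->
  forall q q', valid c q -> valid c q' -> D q -> D q'.
Proof.
move=> DX DY.
have DXE q : valid c q -> D q <-> D (chain_x c q).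
  move=> vq; have [vX XX] := chain_x_valid cT vq; split; first exact: DX.
  by move=> /(DX _ vX); rewrite XX.
have DYE q : valid c q -> D q <-> D (step_y c q).
  move=> vq; have [vY YYY] := step_y_valid cT vq; have [vYY _] := step_y_valid cT vY.
  by split; [exact: DY|move=> /(DY _ vY)/(DY _ vYY); rewrite YYY].
have D0 i j : valid c (i, j) -> D (i, j) <-> D (i, 0).
  elim/ltn_ind: j => -[//|j] IH vij; have /andP[/= ic jd] := vij.
  have [/(_ j.+1) con _] := piece_okP ic; case: con => // [E|[k kj E]].
    have vj : valid c (i, j) by rewrite /valid /= ic ltnW.
    have <- : step_y c (i, j) = (i, j.+1) by rewrite /step_y /= E.
    exact: iff_trans (iff_sym (DYE _ vj)) (IH j _ vj).
  have vk : valid c (i, k) by rewrite /valid /= ic (ltn_trans kj).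
  by apply: iff_trans (DXE _ vij) _; rewrite E; apply: IH.
have D00 i : i < size c -> D (i, 0) <-> D (0, 0).
  elim: i => // i IH ic; have ic' := ltnW ic; apply: iff_trans (IH ic').
  have rd := right_handle_deg cT ic.
  have vr : valid c (i, right_handle (nth piece0 c i)) by rewrite /valid /= ic'.
  rewrite -(chain_x_joint ic); exact: iff_trans (iff_sym (DXE _ vr)) (D0 _ _ vr).
have Dall q : valid c q -> D q <-> D (0, 0).
  by case: q => i j vq; apply: iff_trans (D0 _ _ vq) (D00 _ _); case/andP: vq.
by move=> q q' vq vq' /(Dall _ vq) /(Dall _ vq').
Qed.

End Chain.

(** One exponent kills all cycles outside the marked one. The factor 0 is excluded from the product,
    being divisible by 7. *)
Lemma exists_coprime7 : exists2 L, coprime 7 L & forall k, 0 < k < 200 -> ~~ (7 %| k) -> k %| L.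
Proof.
exists (\prod_(k < 200 | ~~ (7 %| k)) k).
  apply: (big_ind (coprime 7)) => [|m n|k]; first exact: coprimen1.
    by rewrite coprimeMr => -> ->.
  by rewrite prime_coprime.
move=> k /andP[_ lt] n7; rewrite (bigD1 (Ordinal lt)) //=; exact: dvdn_mulr.
Qed.

(** * The Hurwitz triple of a chain *)

Section ChainGroup.
Local Open Scope group_scope.

Lemma chain_hurwitz c : good_chain c -> 4 < sumn (map deg c) ->
  exists x y z : {perm 'I_(sumn (map deg c))},
    [/\ hurwitz_triple ('Alt_('I_(sumn (map deg c))))%G x y z,
        nfix x = tsum (fixed_by [:: true]) c, nfix y = tsum (fixed_by [:: false]) c
      & nfix z = tsum (fixed_by [:: true; false]) c].
Proof.
rewrite -size_points => /and3P[cT cP /eqP cS] n5.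
have Xc q : q \in points c -> chain_x c q \in points c.
  by rewrite !mem_points => /(chain_x_valid cT)[].
have Yc q : q \in points c -> step_y c q \in points c.
  by rewrite !mem_points => /(step_y_valid cT)[].
have XX q : q \in points c -> chain_x c (chain_x c q) = q.
  by rewrite mem_points => /(chain_x_valid cT)[].
have YYY q : q \in points c -> step_y c (step_y c (step_y c q)) = q.
  by rewrite mem_points => /(step_y_valid cT)[].
have [x xE] : exists p : {perm 'I_(size (points c))}, forall k,
    enum_pt (0, 0) (p k) = chain_x c (enum_pt (0, 0) k).
  by apply: perm_of_map (uniq_points c) _ Xc _ => q q' /XX qE /XX q'E E; rewrite -qE E.
have [y yE] : exists p : {perm 'I_(size (points c))}, forall k,
    enum_pt (0, 0) (p k) = step_y c (enum_pt (0, 0) k).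
  by apply: perm_of_map (uniq_points c) _ Yc _ => q q' /YYY qE /YYY q'E E; rewrite -qE E.
pose f := @enum_pt _ (0, 0) (points c).
have fI : injective f by exact: pt_inj (uniq_points c).
have fv k : valid c (f k) by rewrite -mem_points pt_mem.
have fm k : f k \in points c by rewrite pt_mem.
have x2 : x ^+ 2 = 1.
  by apply/permP=> k; apply: fI; rewrite permM perm1 /f !xE XX.
have y3 : y ^+ 3 = 1.
  by apply/permP=> k; apply: fI; rewrite !permM perm1 /f !yE YYY.
have xy7 : (x * y) ^+ 7 = 1.
  apply/permP=> k; apply: fI; rewrite perm1 -[RHS](chain_word_xy7 cT (fv k)).
  by rewrite !expgS expg0 mulg1 !permM /f !(xE, yE).
have wE k : f ((x * y * x * y^-1) k) = chain_word c comm_word (f k).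
  have -> : y^-1 = y * y by apply/eqP; rewrite eq_invg_mul; apply/eqP.
  by rewrite !permM /f !(xE, yE).
set w := x * y * x * y^-1 in wE.
have wmE m k : f ((w ^+ m) k) = iter m (chain_word c comm_word) (f k).
  by elim: m => [|m IH]; rewrite ?perm1 // expgSr permM wE IH.
have [L L7 Ldvd] := exists_coprime7.
(* [i0] is the position of the only piece carrying a marked 7-cycle. *)
have [i0 i0c i0E] := count1_nth piece0 cS.
have [_ /(_ _)[]] := piece_okP cP i0c; first by rewrite i0E.
set cs := marked _ => -[s7 ucs] dcs csE [b bE] [a acs [a' a'cs aE]].
pose C k := marked_pt c (f k).
have CP k : reflect (exists2 j, j \in cs & f k = (i0, j)) (C k).
  apply: (iffP andP) => [[/andP[ic jd] js]|[j jcs ->]]; last first.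
    by rewrite /valid /= i0c dcs.
  have /eqP Ei : (f k).1 == i0 by rewrite -i0E //; apply: contraTneq js => ->.
  by exists (f k).2; [rewrite /cs -Ei|rewrite -Ei; case: (f k)].
have onto j : j \in cs -> exists k, f k = (i0, j).
  by move=> jcs; apply: pt_onto; rewrite mem_points /valid /= i0c dcs.
have iterC m j : j < 7 ->
    iter m (chain_word c comm_word) (i0, nth 0 cs j) = (i0, nth 0 cs ((j + m) %% 7)).
  move=> j7; elim: m => [|m IH]; first by rewrite addn0 modn_small.
  by rewrite iterS IH csE ?ltn_mod // -addn1 modnDml addn1 addnS.
have CPn k : C k -> exists2 j, j < 7 & f k = (i0, nth 0 cs j).
  by case/CP=> j jcs ->; exists (index j cs); rewrite ?nth_index // -s7 index_mem.
have [ka kaE] := onto _ acs.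
have bcs : b \in cs /\ piece_y (nth piece0 c i0) b \in cs.
  have : b \in [seq j <- cs | piece_y (nth piece0 c i0) j \in cs] by rewrite bE mem_head.
  by rewrite mem_filter => /andP[].
have [kb kbE] := onto _ bcs.1.
have tr (B : 'I_(size (points c)) -> Prop) : (forall s, B s -> B (x s)) ->
    (forall s, B s -> B (y s)) ->
    forall s t, B s -> B t.
  move=> Bx By s t Bs.
  (* The property of chain points is transported along the numbering [f]; inverse images are reached
     by writing [k] as [x (x k)] and as [y (y (y k))]. *)
  apply: (@chain_ind c cT cP (fun q => forall k, f k = q -> B k) _ _ (f s) (f t)) => //.
  - move=> q vq IH k kE; rewrite -[k](perm1) -x2 permM; apply/Bx/IH.
    by rewrite /f xE -/(f k) kE XX // mem_points.
  - move=> q vq IH k kE; rewrite -[k](perm1) -y3 !permM; apply/By/IH.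
    by rewrite /f !yE -/(f k) kE YYY // mem_points.
  - by move=> k /fI ->.
have C7 s : C s -> (w ^+ 7) s = s.
  by case/CPn=> j j7 E; apply: fI; rewrite wmE E iterC // modnDr modn_small.
have nth7 j j' : j < 7 -> j' < 7 -> nth 0 cs j = nth 0 cs j' -> j = j'.
  by move=> j7 j'7 /eqP; rewrite nth_uniq ?s7 // => /eqP.
have Cmv s : C s -> w s != s.
  case/CPn=> j j7 E; apply/eqP=> /(congr1 f); rewrite wE E csE // => -[/nth7].
  rewrite ltn_mod j7 => /(_ isT isT); move: j7 {E}; do 7?case: j => [|j] //.
have Ctr s t : C s -> C t -> exists m, t = (w ^+ m) s.
  (* This exponent takes position [j] to [j'] modulo 7 while avoiding a truncated difference. *)
  case/CPn=> j j7 E /CPn[j' j'7 E']; exists (j' + (7 - j)).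
  apply: fI; rewrite wmE E E' iterC //; congr (_, nth _ _ _).
  by rewrite addnCA subnKC ?(ltnW j7) // modnDr modn_small.
have fixL s : ~~ C s -> (w ^+ L) s = s.
  move=> nC; have [k [kr k7 kE]] := comm_word_return cT (fv s) nC.
  have /dvdnP[q ->] := Ldvd k kr k7; apply: fI; rewrite wmE.
  by elim: q => [|q IH]; rewrite ?mul0n // mulSn iterD IH.
have Cka : C ka by apply/CP; exists a.
have Cxka : C (x ka) by apply/CP; exists a' => //; rewrite /f xE -/(f ka) kaE aE.
have Ckb : C kb by apply/CP; exists b => //; case: bcs.
have Cykb : C (y kb).
  by apply/CP; exists (piece_y (nth piece0 c i0) b); [case: bcs|rewrite /f yE -/(f kb) kbE].
have kb_uniq s : C s -> C (y s) -> s = kb.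
  case/CP=> j jcs E /CP[j' j'cs]; rewrite /f yE -/(f s) E => -[E'].
  have : j \in [seq j <- cs | piece_y (nth piece0 c i0) j \in cs] by rewrite mem_filter E' j'cs.
  by rewrite bE inE => /eqP jb; apply: fI; rewrite E kbE jb.
exists x, y, (x * y)^-1; split.
- apply: (@xyH_hurwitz _ x y x2 y3 _ tr C L ka kb) => //; last by rewrite card_ord.
  by rewrite expgVn xy7 invg1.
- rewrite (nfix_count (uniq_points c) xE) -(count_points (v := [:: true])) //.
  by move=> q vq; have [[q1 [E _ _]] _ _ _ _] := triple_okP cT vq; exists q1.
- rewrite (nfix_count (uniq_points c) yE) -(count_points (v := [:: false])) //.
  by move=> q vq; eexists.
have -> : nfix (x * y)^-1 = nfix (x * y) by apply: eq_card => s; rewrite !inE perm_fixV.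
have xyE k : enum_pt (0, 0) ((x * y) k) = step_y c (chain_x c (enum_pt (0, 0) k)) by rewrite permM yE xE.
apply: etrans (nfix_count (uniq_points c) xyE) _; rewrite -(count_points (v := [:: true; false])) //.
move=> q vq; have [[q1 [E _ _]] _ _ _ _] := triple_okP cT vq.
by move: E; rewrite /window_walk /walk /= => ->; eexists.
Qed.

End ChainGroup.

(** * The diagrams *)

(* Found by computer search.  Degree and numbers of fixed points of x, y, z:
    0: 42 (6,0,0)    1: 72 (4,0,2)    2: 14 (2,2,0)    3: 28 (4,1,0)    4: 56 (4,2,0)
    5: 70 (6,1,0)    6: 72 (4,0,2)    7: 87 (3,0,3)    8: 108 (4,0,3)   9: 123 (3,0,4)
   10: 36 (4,0,1)   11: 15 (3,0,1)   12: 51 (3,0,2)   13: 21 (5,0,0)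
   Pieces 2 and 3 only end a chain, so their right handle is out of range; pieces 6 .. 13 only
   begin one, so their right handle is (0, 1). *)
Definition library : seq piece := [::
  Piece
   [:: 0; 1; 3; 2; 6; 9; 4; 11; 12; 5; 15; 7; 8; 24; 18; 10; 21; 27; 14; 33; 22; 16; 20;
    34; 13; 30; 28; 17; 26; 31; 25; 29; 36; 19; 23; 39; 32; 37; 38; 35; 40; 41]
    14 37 [::];
  Piece
   [:: 0; 1; 3; 2; 6; 9; 4; 11; 12; 5; 15; 7; 8; 24; 18; 10; 21; 27; 14; 33; 22; 16; 20;
    36; 13; 30; 39; 17; 40; 31; 25; 29; 42; 19; 48; 54; 23; 57; 52; 26; 28; 45; 32; 44; 43;
    41; 51; 49; 34; 47; 63; 46; 38; 65; 35; 59; 60; 37; 62; 55; 56; 69; 58; 50; 66; 53; 64;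
    68; 67; 61; 70; 71]
    24 70 [::];
  Piece
   [:: 0; 1; 3; 2; 6; 9; 4; 11; 12; 5; 13; 7; 8; 10]
    4 14 [::];
  Piece
   [:: 0; 1; 3; 2; 6; 9; 4; 11; 12; 5; 15; 7; 8; 24; 18; 10; 21; 26; 14; 19; 22; 16; 20;
    23; 13; 27; 17; 25]
    9 28 [::];
  Piece
   [:: 0; 1; 3; 2; 6; 9; 4; 11; 12; 5; 15; 7; 8; 24; 18; 10; 21; 27; 14; 33; 22; 16; 20;
    34; 13; 30; 28; 17; 26; 31; 25; 29; 36; 19; 23; 39; 32; 37; 38; 35; 42; 43; 40; 41; 45;
    44; 48; 51; 46; 53; 54; 47; 55; 49; 50; 52]
    18 37 [::];
  Piece
   [:: 0; 1; 3; 2; 6; 9; 4; 11; 12; 5; 15; 7; 8; 24; 18; 10; 21; 26; 14; 27; 22; 16; 20;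
    30; 13; 69; 17; 19; 32; 33; 23; 36; 28; 29; 42; 39; 31; 41; 45; 35; 51; 37; 34; 48; 54;
    38; 57; 49; 43; 47; 50; 40; 62; 63; 44; 55; 59; 46; 60; 56; 58; 65; 52; 53; 66; 61; 64;
    67; 68; 25]
    23 67 [:: 34; 50; 42; 41; 47; 49; 37];
  Piece
   [:: 0; 1; 3; 2; 6; 9; 4; 11; 12; 5; 15; 7; 8; 24; 18; 10; 21; 27; 14; 33; 22; 16; 20;
    36; 13; 30; 39; 17; 42; 31; 25; 29; 45; 19; 37; 51; 23; 34; 48; 26; 54; 49; 28; 43; 50;
    32; 56; 57; 38; 41; 44; 35; 53; 52; 40; 60; 46; 47; 63; 61; 55; 59; 66; 58; 67; 69; 62;
    64; 68; 65; 71; 70]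
    24 0 [:: 25; 28; 42; 30; 41; 43; 49];
  Piece
   [:: 0; 1; 3; 2; 6; 9; 4; 11; 12; 5; 15; 7; 8; 24; 18; 10; 21; 27; 14; 33; 22; 16; 20;
    36; 13; 30; 39; 17; 42; 31; 25; 29; 45; 19; 37; 51; 23; 34; 48; 26; 54; 49; 28; 43; 50;
    32; 56; 57; 38; 41; 44; 35; 53; 52; 40; 60; 46; 47; 63; 61; 55; 59; 66; 58; 69; 72; 62;
    75; 70; 64; 68; 79; 65; 81; 78; 67; 80; 84; 74; 71; 76; 73; 83; 82; 77; 86; 85]
    29 0 [:: 25; 28; 42; 30; 41; 43; 49];
  Piece
   [:: 0; 1; 3; 2; 6; 9; 4; 11; 12; 5; 15; 7; 8; 24; 18; 10; 21; 27; 14; 33; 22; 16; 20;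
    26; 13; 30; 23; 17; 36; 31; 25; 29; 39; 19; 35; 34; 28; 41; 42; 32; 45; 37; 38; 51; 48;
    40; 50; 54; 44; 60; 46; 43; 57; 63; 47; 66; 58; 52; 56; 59; 49; 75; 78; 53; 69; 72; 55;
    81; 70; 64; 68; 84; 65; 79; 76; 61; 74; 87; 62; 73; 82; 67; 80; 90; 71; 93; 91; 77; 89;
    88; 83; 86; 96; 85; 98; 99; 92; 102; 94; 95; 103; 101; 97; 100; 105; 104; 107; 106]
    36 0 [:: 43; 59; 51; 50; 56; 58; 46];
  Piece
   [:: 0; 1; 3; 2; 6; 9; 4; 11; 12; 5; 15; 7; 8; 24; 18; 10; 21; 27; 14; 28; 22; 16; 20;
    33; 13; 30; 36; 17; 19; 31; 25; 29; 39; 23; 35; 34; 26; 42; 40; 32; 38; 45; 37; 48; 51;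
    41; 54; 49; 43; 47; 60; 44; 63; 57; 46; 59; 66; 53; 69; 55; 50; 72; 75; 52; 78; 71; 56;
    81; 74; 58; 90; 65; 61; 73; 68; 62; 84; 79; 64; 77; 82; 67; 80; 87; 76; 89; 93; 83; 96;
    85; 70; 92; 91; 86; 99; 97; 88; 95; 102; 94; 105; 108; 98; 111; 106; 100; 104; 115; 101;
    117; 114; 103; 116; 120; 110; 107; 112; 109; 119; 118; 113; 122; 121]
    41 0 [:: 61; 72; 77; 81; 73; 67; 79];
  Piece
   [:: 0; 1; 3; 2; 6; 9; 4; 11; 12; 5; 15; 7; 8; 21; 18; 10; 19; 24; 14; 16; 20; 13; 27;
    30; 17; 31; 28; 22; 26; 33; 23; 25; 32; 29; 35; 34]
    12 0 [::];
  Piece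
   [:: 0; 1; 3; 2; 6; 9; 4; 11; 8; 5; 12; 7; 10; 14; 13]
    5 0 [::];
  Piece
   [:: 0; 1; 3; 2; 6; 9; 4; 11; 12; 5; 15; 7; 8; 24; 18; 10; 21; 27; 14; 33; 22; 16; 20;
    36; 13; 30; 39; 17; 40; 31; 25; 29; 42; 19; 37; 48; 23; 34; 47; 26; 28; 45; 32; 44; 43;
    41; 46; 38; 35; 50; 49]
    17 0 [::];
  Piece
   [:: 0; 1; 3; 2; 6; 9; 4; 11; 12; 5; 15; 7; 8; 18; 14; 10; 20; 17; 13; 19; 16]
    7 0 [::]].

Definition piece_at i := nth piece0 library i.

(* Entry r gives the beginnings of two chains for n = r mod 14.  Their degrees agree, while the
   second has seven fixed points of z fewer than the first. *)
Definition heads : seq (seq nat * seq nat) :=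
  let mk2 s j := s :: nseq j 1 in
  let mk1 s j k := s ++ nseq j 1 ++ [:: 5; 4] ++ nseq k 0 in
  [:: (mk2 8 2, mk1 [::] 0 3);
      (mk2 9 2, mk1 [:: 11] 0 3);
      (mk2 8 3, mk1 [::] 1 3);
      (mk2 9 3, mk1 [:: 11] 1 3);
      (mk2 8 4, mk1 [::] 2 3);
      (mk2 9 4, mk1 [:: 11] 2 3);
      (mk2 8 5, mk1 [::] 3 3);
      (mk2 7 2, mk1 [:: 13] 0 2);
      (mk2 6 3, mk1 [:: 10] 0 3);
      (mk2 7 3, mk1 [:: 12] 0 3);
      (mk2 6 4, mk1 [:: 10] 1 3);
      (mk2 7 4, mk1 [:: 12] 1 3);
      (mk2 6 5, mk1 [:: 10] 2 3);
      (mk2 7 5, mk1 [:: 12] 2 3)].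

Definition tails : seq (seq nat) := [:: [::]; [:: 2]; [:: 3]].

(** * Lengthening the chains *)

Definition family (h e : seq nat) a := h ++ nseq a 0 ++ e.

Lemma triples_map (T U : Type) (g : T -> U) prev s :
  triples (omap g prev) (map g s) =
  [seq (omap g t.1.1, g t.1.2, omap g t.2) | t <- triples prev s].
Proof. by elim: s prev => //= b s IH prev; rewrite -(IH (Some b)); case: s {IH}. Qed.

(** Once there are two copies of piece 0, a further copy only contributes a window of three copies.
    Hence finitely many windows occur, and window sums grow linearly. *)
Lemma triples_family (h e : seq nat) a :
  perm_eq (triples None (family h e a.+3))
    ((Some 0, 0, Some 0) :: triples None (family h e a.+2)).
Proof.
rewrite /family; apply/seq.permP => p; elim: h None => [|b h IH] prev; first exact: addnCA.
rewrite !cat_cons /= IH /= addnCA; do 2!congr addn.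
by case: h {IH}.
Qed.

Definition piece_window (t : option nat * nat * option nat) := (omap piece_at t.1.1, piece_at t.1.2, omap piece_at t.2).

Definition families := [seq (h, e) | h <- map fst heads ++ map snd heads, e <- tails].

Definition windows : seq (option nat * nat * option nat) :=
  undup (flatten [seq flatten [seq triples None (family he.1 he.2 a) | a <- iota 0 4] | he <- families]).

Lemma windows_ok : all (fun t => triple_ok (piece_window t)) windows.
Proof. by vm_cast_no_check (erefl true). Qed.

Lemma family_windows h e a : (h, e) \in families ->
  {subset triples None (family h e a) <= windows}.
Proof.
move=> he t; rewrite mem_undup => ta; apply/flattenP.
exists (flatten [seq triples None (family h e b) | b <- iota 0 4]).
  by apply/mapP; exists (h, e).
have small b : b < 4 -> t \in triples None (family h e b) ->
    t \in flatten [seq triples None (family h e b') | b' <- iota 0 4].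
  move=> b4 tb; apply/flattenP; exists (triples None (family h e b)) => //.
  by apply/mapP; exists b; rewrite ?mem_iota.
have mid : (Some 0, 0, Some 0) \in triples None (family h e 3).
  by rewrite (perm_mem (triples_family h e 0)) mem_head.
elim: a ta => [|[|[|a]] IH]; [exact: small|exact: small|exact: small|].
by rewrite (perm_mem (triples_family h e a)) inE => /predU1P[tE|//]; apply: (small 3); rewrite ?tE.
Qed.

Lemma tsum_family f h e a :
  tsum f (map piece_at (family h e a.+2)) =
  a * f (Some (piece_at 0), piece_at 0, Some (piece_at 0)) + tsum f (map piece_at (family h e 2)).
Proof.
elim: a => [|a IH]; first by rewrite mul0n.
rewrite mulSn -addnA -IH /tsum !(triples_map piece_at None) -!map_comp.
by rewrite (perm_sumn (perm_map _ (triples_family h e a))).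
Qed.

(** From two copies on, both sums grow by the same amount per copy, so the inequality at 2
    persists. *)
Lemma tsum_family_neq f h1 h2 e :
  all (fun a => tsum f (map piece_at (family h1 e a)) != tsum f (map piece_at (family h2 e a))) (iota 0 3) ->
  forall a, tsum f (map piece_at (family h1 e a)) <> tsum f (map piece_at (family h2 e a)).
Proof.
move=> /and4P[/eqP n0 /eqP n1 /eqP n2 _] [|[|a]] //.
by rewrite (tsum_family f h1) (tsum_family f h2) => /addnI.
Qed.

Definition degree s := sumn (map deg (map piece_at s)).

Lemma degree_family h e a : degree (family h e a) = degree h + 42 * a + degree e.
Proof.
rewrite /degree /family !map_cat !sumn_cat addnA; congr (_ + _ + _).
by elim: a => //= a ->; rewrite mulnS.
Qed.

Lemma library_ok : all piece_ok library. Proof. by vm_compute. Qed.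

Lemma family_good h e a : (h, e) \in families -> good_chain (map piece_at (family h e a)).
Proof.
move=> he; apply/and3P; split.
- rewrite (triples_map piece_at None) all_map; apply/allP => t /(family_windows he) tw.
  exact: (allP windows_ok).
- rewrite all_map; apply/allP=> i _ /=; have [lt|ge] := ltnP i (size library).
    by have /(all_nthP piece0) := library_ok; apply.
  by rewrite /piece_at nth_default.
(* Piece 0 has no marked cycle, so its copies do not change the count. *)
have -> : count (fun p => marked p != [::]) (map piece_at (family h e a)) =
    count (fun i => marked (piece_at i) != [::]) (h ++ e).
  rewrite count_map /family !count_cat; congr addn.
  by rewrite (_ : count _ (nseq a 0) = 0) //; elim: a.
have /allP/(_ _ he) : all (fun he => count (fun i => marked (piece_at i) != [::]) (he.1 ++ he.2) == 1) families.
  by vm_compute.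
by [].
Qed.

(** The finite checks for one residue; [4 <] provides the simplicity of the alternating group. *)
Definition heads_ok r :=
  let: (h2, h1) := nth ([::], [::]) heads r in
  [&& degree h1 == degree h2, degree h2 %% 14 == r, 4 < degree h2 <= dHB_bound r,
      all (fun k => degree (nth [::] tails k) == 14 * k) (iota 0 3)
    & all (fun v => all (fun e => all (fun a =>
        tsum (fixed_by v) (map piece_at (family h1 e a)) != tsum (fixed_by v) (map piece_at (family h2 e a)))
        (iota 0 3)) tails) [:: [:: true]; [:: false]; [:: true; false]]].

Lemma all_heads_ok : all heads_ok (iota 0 14).
Proof. by vm_cast_no_check (erefl true). Qed.

Lemma dHB_Alt r n : r < 14 -> n = r %[mod 14] -> dHB_bound r <= n -> dHB_group ('Alt_('I_n))%G.
Proof.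
move=> r14 nr bn; have /allP/(_ r) := all_heads_ok; rewrite mem_iota r14 => /(_ isT).
rewrite /heads_ok; case E: (nth _ heads r) => [h2 h1].
case/and5P=> /eqP d12 /eqP d2r /andP[d5 d2b] /allP tl /allP neq.
have d2n := leq_trans d2b bn.
(* The missing degree is [14 * m]: [m %/ 3] copies of the piece of degree 42, then the tail of
   degree [14 * (m %% 3)]. *)
have /dvdnP[m Em] : 14 %| n - degree h2 by rewrite -eqn_mod_dvd // nr d2r modn_small.
pose e := nth [::] tails (m %% 3); have m3 : m %% 3 < 3 by rewrite ltn_mod.
have de : degree e = 14 * (m %% 3) by apply/eqP/tl; rewrite mem_iota.
have et : e \in tails by exact: mem_nth.
have dn h : degree h = degree h2 -> sumn (map deg (map piece_at (family h e (m %/ 3)))) = n.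
  move=> dh; rewrite -/(degree _) degree_family de dh -(subnKC d2n) Em -addnA; congr addn.
  rewrite [in RHS](divn_eq m 3) mulnDl -mulnA [14 * _]mulnC; congr addn.
  by rewrite mulnC.
have hr h : h \in [:: h2; h1] -> (h, e) \in families.
  rewrite in_cons mem_seq1 => hh; apply: allpairs_f => //; rewrite mem_cat; apply/orP.
  have hr : (h2, h1) \in heads by rewrite -E mem_nth.
  by case/orP: hh => /eqP->; [left|right]; apply/mapP; exists (h2, h1).
have n5 : 4 < n by apply: leq_trans d2n.
have ex h : degree h = degree h2 -> h \in [:: h2; h1] -> exists x y z : {perm 'I_n},
    [/\ hurwitz_triple ('Alt_('I_n))%G x y z,
      nfix x = tsum (fixed_by [:: true]) (map piece_at (family h e (m %/ 3))),
      nfix y = tsum (fixed_by [:: false]) (map piece_at (family h e (m %/ 3)))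
    & nfix z = tsum (fixed_by [:: true; false]) (map piece_at (family h e (m %/ 3)))].
  move=> dh hh; have := chain_hurwitz (family_good (m %/ 3) (hr h hh)).
  by rewrite (dn h dh); apply.
have [||x1 [y1 [z1 [H1 fx1 fy1 fz1]]]] := ex h1; rewrite ?inE ?eqxx ?orbT //.
have [||x2 [y2 [z2 [H2 fx2 fy2 fz2]]]] := ex h2; rewrite ?inE ?eqxx //.
have neqv v : v \in [:: [:: true]; [:: false]; [:: true; false]] ->
    tsum (fixed_by v) (map piece_at (family h1 e (m %/ 3))) <> tsum (fixed_by v) (map piece_at (family h2 e (m %/ 3))).
  by move=> /neq /allP/(_ e et) ?; apply: tsum_family_neq.
by apply: (dHB_nfix H1 H2); rewrite ?(fx1, fx2, fy1, fy2, fz1, fz2); apply: neqv.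
Qed.

Theorem theorem1p1 :
  (forall r n : nat, r < 14 -> n = r %[mod 14] -> dHB_bound r <= n ->
     dHB_group ('Alt_('I_n))%G) /\
  (forall n : nat, 589 <= n -> dHB_group ('Alt_('I_n))%G).
Proof.
split=> [r n|n n589]; first exact: dHB_Alt.
apply: (@dHB_Alt (n %% 14)); rewrite ?ltn_mod ?modn_mod //.
(* 589 is the largest of the fourteen bounds, which is checked residue by residue. *)
apply: leq_trans n589; have := ltn_mod n 14.
by move: (n %% 14); do 14?[case=> [|]] => //.
Qed.
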